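(* Let $\mathbf{N} \in \mathbb{R}^{n\times p}$ be a random matrix with independent entries having symmetric distributions, i.e., $N_{ij} =_d -N_{ij}$ for all $i,j$ (the entries need not be identically distributed). Consider the null hypothesis $H_0$ of no signal ($k=0$), under which the data matrix is $\mathbf{X}=\mathbf{N}$. Let $\hat k$ be the output of FlipPA applied to $\mathbf{X}$ with quantile $q\in[0,1]$, number of trials $T\ge 1$ and threshold $\tau\ge 0$. Then, for both the upper-edge and the pairwise comparison methods, $$\Pr_{H_0}\bigl[\hat k>0\bigr]\le 1-\frac{\lfloor qT\rfloor}{T+1}.$$
   Context: FlipPA. Input: $\mathbf{X}\in\mathbb{R}^{n\times p}$, $q\in[0,1]$, integer $T\ge1$, $\tau\ge0$. Let $\mathbf{R}^{(1)},\dots,\mathbf{R}^{(T)}$ be independent random matrices, each uniform on $\{-1,+1\}^{n\times p}$, and independent of $\mathbf{X}$. For $t=1,\dots,T$ let $\tilde{\mathbf{X}}^{(t)}=\mathbf{R}^{(t)}\circ\mathbf{X}$ ($\circ$ is the entrywise product), with singular values $\tilde\sigma^{(t)}_1\ge\tilde\sigma^{(t)}_2\ge\cdots$. Let $\sigma_1\ge\sigma_2\ge\cdots$ be the singular values of $\mathbf{X}$. Singular values with index larger than $\min(n,p)$ are taken to be $0$. The output $\hat k$ is the smallest integer $j\ge0$ such that - (pairwise comparison) $\sigma_{j+1}\le \text{$q$-quantile of }(\tilde\sigma^{(1)}_{j+1},\dots,\tilde\sigma^{(T)}_{j+1})+\tau$, or - (upper-edge comparison) $\sigma_{j+1}\le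 \text{$q$-quantile of }(\tilde\sigma^{(1)}_{1},\dots,\tilde\sigma^{(T)}_{1})+\tau$. Sample quantiles. The $q$-quantile of a sample $x_1,\dots,x_T$ is computed by any one (fixed) of the nine definitions enumerated by Hyndman and Fan (1996). With order statistics $x_{(1)}\le\dots\le x_{(T)}$ and the conventions $x_{(j)}=x_{(1)}$ for $j<1$, $x_{(j)}=x_{(T)}$ for $j>T$, it equals $(1-c)x_{(j)}+c\,x_{(j+1)}$ with $j=\lfloor qT+m\rfloor$, $g=qT+m-j$, where: type 1: $m=0$, $c=\mathbf{1}(g>0)$; type 2: $m=0$, $c=1$ if $g>0$ and $c=1/2$ if $g=0$; type 3: $m=-1/2$, $c=0$ if $g=0$ and $j$ is even, $c=1$ otherwise; types 4–9: $c=g$ and $m=0,\ 1/2,\ q,\ 1-q,\ (q+1)/3,\ q/4+3/8$ respectively. *)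

(* Defs.v *)
From HB Require Import structures.
From mathcomp Require Import all_boot all_order all_algebra.
From mathcomp Require Import all_classical all_reals all_analysis.
From mathcomp Require polyrcf.

Set Implicit Arguments.
Unset Strict Implicit.
Unset Printing Implicit Defensive.

Import Order.TTheory GRing.Theory Num.Theory.
Import numFieldNormedType.Exports.

Local Open Scope classical_set_scope.
Local Open Scope ring_scope.

(* Real eigenvalues of A in increasing order ([polyrcf.rootsR] is increasing),
   each repeated according to its multiplicity in the characteristic
   polynomial. *)
Definition eigenvalues (R : realType) (m : nat) (A : 'M[R]_m) : seq R :=
  flatten [seq nseq (mup x (char_poly A)) x | x <- polyrcf.rootsR (char_poly A)].

(* Indices start at 0: [singular_value X j] is $\sigma_{j+1}$, the square root
   of the (j+1)-st largest eigenvalue of $X^T X$. *)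
Definition singular_value (R : realType) (n p : nat) (X : 'M[R]_(n, p))
    (j : nat) : R :=
  if (j < minn n p)%N then Num.sqrt (rev (eigenvalues (X^T *m X)))`_j else 0.

(* [order_stat x j] is $x_{(j)}$, with j counted from 1 and clamped to 1..T. *)
Definition order_stat (R : realType) (T : nat) (x : 'I_T -> R) (j : int) : R :=
  (sort <=%R [seq x t | t : 'I_T])`_(`|Num.min (Num.max j 1) T%:Z|%N.-1).

(* The nine sample quantiles of Hyndman and Fan (1996). *)
Inductive quantile_type : Set :=
  | HF1 | HF2 | HF3 | HF4 | HF5 | HF6 | HF7 | HF8 | HF9.

Definition quantile_shift (R : realType) (ty : quantile_type) (q : R) : R :=
  match ty with
  | HF1 | HF2 | HF4 => 0
  | HF3 => - (1 / 2)
  | HF5 => 1 / 2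
  | HF6 => q
  | HF7 => 1 - q
  | HF8 => (q + 1) / 3
  | HF9 => q / 4 + 3 / 8
  end.

Definition quantile_weight (R : realType) (ty : quantile_type) (j : int)
    (g : R) : R :=
  match ty with
  | HF1 => if 0 < g then 1 else 0
  | HF2 => if 0 < g then 1 else 1 / 2
  | HF3 => if (g == 0) && ~~ odd `|j|%N then 0 else 1
  | _ => g
  end.

Definition sample_quantile (R : realType) (ty : quantile_type) (q : R)
    (T : nat) (x : 'I_T -> R) : R :=
  let h := q * T%:R + quantile_shift ty q in
  let j := Num.floor h in
  let c := quantile_weight ty j (h - j%:~R) in
  (1 - c) * order_stat x j + c * order_stat x (j + 1).

Inductive comparison_method : Set := Pairwise | UpperEdge.

Definition signflip (R : realType) (n p : nat) (S X : 'M[R]_(n, p)) :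
    'M[R]_(n, p) :=
  map2_mx *%R S X.

(* The comparison made at index j+1, i.e. that of $\sigma_{j+1}$. *)
Definition flippa_stop (R : realType) (cmp : comparison_method)
    (ty : quantile_type) (q tau : R) (n p T : nat)
    (X : 'M[R]_(n, p)) (S : 'I_T -> 'M[R]_(n, p)) (j : nat) : bool :=
  let l := match cmp with Pairwise => j | UpperEdge => 0%N end in
  singular_value X j <=
    sample_quantile ty q (fun t => singular_value (signflip (S t) X) l) + tau.

Lemma singular_value_ge0 (R : realType) (n p : nat) (X : 'M[R]_(n, p)) j :
  0 <= singular_value X j.
Proof. by rewrite /singular_value; case: ifP => // _; exact: sqrtr_ge0. Qed.

Lemma order_stat_ge0 (R : realType) (T : nat) (x : 'I_T -> R) j :
  (forall t, 0 <= x t) -> 0 <= order_stat x j.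
Proof.
move=> x0; rewrite /order_stat; set s := sort _ _; set k := _.-1.
have [ks|ks] := ltnP k (size s); last by rewrite nth_default.
have : s`_k \in s by exact: mem_nth.
by rewrite mem_sort => /mapP[t _ ->].
Qed.

Lemma quantile_weight_itv (R : realType) ty j (g : R) :
  0 <= g < 1 -> 0 <= quantile_weight ty j g <= 1.
Proof.
move=> /andP[g0 g1].
by case: ty => /=; rewrite ?g0 ?(ltW g1) //; case: ifP => _;
  rewrite ?ler01 ?lexx // divr_ge0 //= ler_pdivrMr ?mul1r ?ler1n.
Qed.

Lemma sample_quantile_ge0 (R : realType) ty (q : R) (T : nat) (x : 'I_T -> R) :
  (forall t, 0 <= x t) -> 0 <= sample_quantile ty q x.
Proof.
move=> x0; rewrite /sample_quantile /=.
set h := _ + quantile_shift _ _; set c := quantile_weight _ _ _.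
have /andP[c0 c1] : 0 <= c <= 1.
  apply: quantile_weight_itv; rewrite subr_ge0 ltrBlDl.
  by have := floor_itv h; rewrite intrD.
by rewrite addr_ge0// mulr_ge0 ?subr_ge0 ?order_stat_ge0.
Qed.

Lemma flippa_stop_exists (R : realType) cmp ty (q tau : R) (n p T : nat)
    (X : 'M[R]_(n, p)) (S : 'I_T -> 'M[R]_(n, p)) :
  0 <= tau -> exists j, flippa_stop cmp ty q tau X S j.
Proof.
move=> tau0; exists (minn n p); rewrite /flippa_stop {1}/singular_value ltnn.
rewrite addr_ge0// sample_quantile_ge0// => t.
exact: singular_value_ge0.
Qed.

Definition flippa (R : realType) (cmp : comparison_method)
    (ty : quantile_type) (q tau : R) (tau0 : 0 <= tau) (n p T : nat)
    (X : 'M[R]_(n, p)) (S : 'I_T -> 'M[R]_(n, p)) : nat :=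
  ex_minn (flippa_stop_exists cmp ty q X S tau0).

Definition random_matrix (R : realType) (d : measure_display)
    (Omega : measurableType d) (P : probability Omega R) (n p : nat)
    (Y : 'I_n -> 'I_p -> {RV P >-> R}) (w : Omega) : 'M[R]_(n, p) :=
  \matrix_(i, j) Y i j w.

Definition generated_sigma (R : realType) (d : measure_display)
    (Omega : measurableType d) (P : probability Omega R) (I : Type)
    (Y : I -> {RV P >-> R}) : set (set Omega) :=
  <<s \bigcup_i preimage_set_system setT (Y i) measurable >>.

(* Mutual independence of a finite family of sigma-algebras. *)
Definition mutually_independent (R : realType) (d : measure_display)
    (Omega : measurableType d) (P : probability Omega R) (I : finType)
    (F : I -> set (set Omega)) : Prop :=
  forall (J : {set I}) (A : I -> set Omega),
    (forall i, i \in J -> F i (A i)) ->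
    P (\bigcap_(i in [set` J]) A i) = (\prod_(i in J) P (A i))%E.

Definition independent_pair (R : realType) (d : measure_display)
    (Omega : measurableType d) (P : probability Omega R)
    (F G : set (set Omega)) : Prop :=
  forall A B, F A -> G B -> P (A `&` B) = (P A * P B)%E.

Definition independent_entries (R : realType) (d : measure_display)
    (Omega : measurableType d) (P : probability Omega R) (n p : nat)
    (Y : 'I_n -> 'I_p -> {RV P >-> R}) : Prop :=
  mutually_independent P (fun ij : 'I_n * 'I_p =>
    generated_sigma (fun _ : unit => Y ij.1 ij.2)).

Definition symmetric_distribution (R : realType) (d : measure_display)
    (Omega : measurableType d) (P : probability Omega R)
    (Y : {RV P >-> R}) : Prop :=
  forall B : set R, measurable B ->
    distribution P Y B = pushforward P (fun w => - Y w) B.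

(* Uniform law on $\{-1,+1\}^{n\times p}$. *)
Definition uniform_signs (R : realType) (d : measure_display)
    (Omega : measurableType d) (P : probability Omega R) (n p : nat)
    (Y : 'I_n -> 'I_p -> {RV P >-> R}) : Prop :=
  forall S : 'M[R]_(n, p), (forall i j, S i j = 1 \/ S i j = -1) ->
    P [set w | random_matrix Y w = S] = ((2 ^+ (n * p))^-1)%:E.

Definition independent_matrices (R : realType) (d : measure_display)
    (Omega : measurableType d) (P : probability Omega R) (n p T : nat)
    (S : 'I_T -> 'I_n -> 'I_p -> {RV P >-> R}) : Prop :=
  mutually_independent P (fun t : 'I_T =>
    generated_sigma (fun ij : 'I_n * 'I_p => S t ij.1 ij.2)).

Definition jointly_independent_of (R : realType) (d : measure_display)
    (Omega : measurableType d) (P : probability Omega R) (n p T : nat)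
    (S : 'I_T -> 'I_n -> 'I_p -> {RV P >-> R})
    (X : 'I_n -> 'I_p -> {RV P >-> R}) : Prop :=
  independent_pair P
    (generated_sigma (fun tij : 'I_T * 'I_n * 'I_p => S tij.1.1 tij.1.2 tij.2))
    (generated_sigma (fun ij : 'I_n * 'I_p => X ij.1 ij.2)).

(* Main.v *)
(* Only [sigma_1] matters: the output is positive iff [sigma_1(N)] exceeds the
   [q]-quantile of the [sigma_1(S_t o N)] by more than [tau], and then
   [sigma_1(N)] is larger than at least [k := floor(q T)] of them, whatever the
   quantile type.  For every fixed sign matrix [g], the matrices [N] and [g o N]
   have the same law, so after averaging over [g] the event concerns the [T + 1]
   values [sigma_1(g_i o X)], with [X] fixed and [(g_0, g_1, ...)] uniform on
   the tuples of sign matrices.  These values are exchangeable, and at most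
   [T + 1 - k] of [T + 1] numbers can be larger than [k] of the others.  Of
   [sigma_1] only its measurability is used. *)
Require Import Defs.
From HB Require Import structures.
From mathcomp Require Import all_boot all_order all_algebra.
From mathcomp Require Import all_classical all_reals all_analysis.
From mathcomp Require Import measurable_realfun perm zify ring lra.
From mathcomp Require polyrcf.
Set Implicit Arguments.
Unset Strict Implicit.
Unset Printing Implicit Defensive.
Import Order.TTheory GRing.Theory Num.Theory.
Import numFieldNormedType.Exports.
Local Open Scope classical_set_scope.
Local Open Scope ring_scope.

(** * Order statistics and sample quantiles *)

(** In the sorted list the entries below [y] form an initial segment, and position [k], counted from
    0, lies in it exactly when it has more than [k] entries. *)
Lemma nth_sort_lt (R : realType) (s : seq R) (k : nat) (y : R) :
  (k < size s)%N -> ((sort <=%R s)`_k < y) = (k < count (< y) s)%N.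
Proof.
move=> ks; have cE := seq.permP (permEl (perm_sort <=%R s)) (< y).
rewrite -cE; set u := sort <=%R s.
have su : sorted <=%R u by exact: sort_le_sorted.
have {}ks : (k < size u)%N by rewrite size_sort.
apply/idP/idP => [uky|].
  have : all (< y) (take k.+1 u).
    apply/(all_nthP 0) => i; rewrite size_takel // ltnS => ik.
    rewrite nth_take ?ltnS //; apply: le_lt_trans uky.
    by apply: (sorted_leq_nth le_trans le_refl) => //;
      rewrite inE // (leq_ltn_trans ik).
  rewrite all_count size_takel // => /eqP ck.
  by rewrite -(cat_take_drop k.+1 u) count_cat ck leq_addr.
apply: contraTT; rewrite -leNgt -leqNgt => yu.
have : ~~ has (< y) (drop k u).
  apply/hasPn => x /(nthP 0) [i]; rewrite size_drop ltn_subRL nth_drop => ik <-.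
  rewrite -leNgt; apply: le_trans yu _.
  by apply: (sorted_leq_nth le_trans le_refl) => //; rewrite ?inE // leq_addr.
rewrite has_count -leqNgt leqn0 => /eqP c0.
rewrite -(cat_take_drop k u) count_cat c0 addn0.
rewrite (leq_trans (count_size _ _)) // size_take.
by case: ifP => // /negbT; rewrite -leqNgt.
Qed.

Lemma order_stat_lt (R : realType) (T : nat) (x : 'I_T -> R) (j : int) (y : R) :
  (0 < T)%N ->
  (order_stat x j < y) =
  (`|Num.min (Num.max j 1) T%:Z|%N.-1 < #|[pred t | x t < y]%R|)%N.
Proof.
move=> T0; rewrite /order_stat nth_sort_lt; last first.
  by rewrite size_map size_enum_ord; lia.
by rewrite count_map cardE enumT /= size_filter -enumT.
Qed.

Lemma order_stat_le (R : realType) (T : nat) (x : 'I_T -> R) (i j : int) :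
  (0 < T)%N -> i <= j -> order_stat x i <= order_stat x j.
Proof.
move=> T0 ij; rewrite leNgt; apply/negP => ji.
(* With [y] the [i]-th order statistic itself: more than index [j] many values would lie below it,
   hence more than index [i] many, and it would be below itself. *)
have := ltxx (order_stat x i); rewrite order_stat_lt //.
move: ji; rewrite order_stat_lt // => /(leq_trans _) -> //; lia.
Qed.

(** If [j >= k], where [k] is the floor of [q T], the quantile is a convex combination of two order
    statistics of index at least [k]. Otherwise the shift is negative, which leaves type 3, and
    there the quantile is the [k]-th order statistic itself. *)
Lemma order_stat_le_quantile (R : realType) (ty : quantile_type) (q : R)
    (T : nat) (x : 'I_T -> R) :
  0 <= q <= 1 -> (0 < T)%N ->
  order_stat x (Num.floor (q * T%:R)) <= sample_quantile ty q x.
Proof.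
move=> /andP[q0 q1] T0; rewrite /sample_quantile /=.
set k := Num.floor _; set h := _ + quantile_shift _ _; set j := Num.floor h.
have /andP[kq qk] := floor_itv (q * T%:R).
have /andP[jh hj] := floor_itv h.
rewrite -/k -/j in kq qk jh hj; rewrite !intrD in qk hj.
have /andP[c0 c1] : 0 <= quantile_weight ty j (h - j%:~R) <= 1.
  by apply: quantile_weight_itv; rewrite subr_ge0 jh ltrBlDl.
have [kj|jk] := leP k j.
  have := order_stat_le x T0 kj; have := order_stat_le x T0 (ler_wpDr ler01 kj).
  set u := order_stat x k; set v := order_stat x j.
  set w := order_stat x (j + 1).
  set c := quantile_weight _ _ _ in c0 c1 *; nra.
have m0 : quantile_shift ty q < 0.
  by rewrite ltNge; apply: contraTN jk => m0; rewrite -leNgt le_floor // lerDl.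
have ty3 : ty = HF3.
  by move: m0; case: (ty) => //= m0; exfalso; move: q0 q1 m0; clear; lra.
have hE : h = q * T%:R - 1 / 2 by rewrite /h ty3.
have jk1 : j + 1 = k.
  apply/eqP; rewrite eq_le lezD1 jk /= -ltzD1 -(ltr_int R) !intrD.
  by rewrite hE in hj; lra.
(* Here [g = q T - k + 1/2] is at least 1/2, hence nonzero, and type 3 gives weight 1. *)
have -> : quantile_weight ty j (h - j%:~R) = 1.
  rewrite ty3 /= (_ : (_ == 0) = false) //.
  by apply/eqP; move: kq; rewrite -jk1 intrD hE; lra.
by rewrite subrr mul0r mul1r add0r jk1.
Qed.

Lemma floor_le_count_lt (R : realType) (ty : quantile_type) (q : R)
    (T : nat) (x : 'I_T -> R) (y : R) :
  0 <= q <= 1 -> (0 < T)%N -> sample_quantile ty q x < y ->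
  (`|Num.floor (q * T%:R)| <= #|[pred t | x t < y]%R|)%N.
Proof.
move=> q01 T0 /(le_lt_trans (order_stat_le_quantile ty x q01 T0)).
have /andP[q0 q1] := q01; rewrite order_stat_lt //.
have k0 : 0 <= Num.floor (q * T%:R) by rewrite floor_ge0 mulr_ge0.
(* With [k <= T] the index is not clamped from above, and [k - 1 < count] is the claim; for [k = 0]
   the claim is trivial. *)
have kT : Num.floor (q * T%:R) <= T.
  rewrite -(ler_int R); apply: le_trans (floor_le _) _.
  by rewrite ler_piMl.
lia.
Qed.

(** * Ranks in a finite family *)

(** Take [i] with the smallest value among the indices of rank at least [k]. All these indices avoid
    the set of [j] with [y j < y i], which has at least [k] elements. *)
Lemma card_rank_ge (R : realType) (I : finType) (y : I -> R) (k : nat) :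
  (#|[pred i | k <= #|[pred j | (y j < y i)%R]|]| <= #|I| - k)%N.
Proof.
case: (pickP [pred i | k <= #|[pred j | (y j < y i)%R]|]%N) => [i0 ki0|E];
  last by rewrite eq_card0.
have [i ki imin] := arg_minP y ki0.
rewrite leq_subRL; last exact: leq_trans ki (max_card _).
rewrite -(cardC [pred j | y j < y i]) leq_add // subset_leq_card //.
by apply/fintype.subsetP => j; rewrite !inE => /imin; rewrite leNgt.
Qed.

(** * Measurability of the largest singular value *)

(** Used to discard multiplicities: the last entry of [eigenvalues] is the largest distinct root. *)
Lemma last_flatten_nseq (T : eqType) (m : T -> nat) (r : seq T) (z : T) :
  {in r, forall x, (0 < m x)%N} ->
  last z (flatten [seq nseq (m x) x | x <- r]) = last z r.
Proof.
elim: r z => //= x r IH z m0; rewrite last_cat IH; last first.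
  by move=> y yr; apply: m0; rewrite inE yr orbT.
congr last; have := m0 x (mem_head _ _).
by case: (m x) => // k _ /=; elim: k.
Qed.

(** For an empty list [last] returns the default 0, and [0 <= c] makes both sides false. *)
Lemma lt_last_sorted (R : realType) (r : seq R) (c : R) :
  sorted <%R r -> 0 <= c -> c < last 0 r <-> exists2 x, x \in r & c < x.
Proof.
move=> sr c0; split=> [cr|[x xr cx]].
  exists (last 0 r) => //; case: r {sr} cr => [|x r] /=.
    by rewrite ltNge c0.
  by rewrite mem_last.
apply: lt_le_trans cx _; rewrite -nth_last.
move: xr => /(nthP 0) [i ir <-].
apply: (sorted_leq_nth le_trans le_refl).
- by apply: sub_sorted sr => ? ?; exact: ltW.
- by rewrite inE.
- by rewrite inE; case: (r) ir.
- by case: (r) ir.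
Qed.

Lemma lt_max_eigenvalue (R : realType) (m : nat) (A : 'M[R]_m) (c : R) :
  0 <= c ->
  c < (rev (eigenvalues A))`_0 <->
  exists2 x, root (char_poly A) x & c < x.
Proof.
move=> c0; set p := char_poly A.
have p0 : p != 0 by exact: monic_neq0 (char_poly_monic A).
have rootsE x : (x \in polyrcf.rootsR p) = root p x.
  by rewrite -(polyrcf.roots_on_rootsR p0) in_itv.
have -> : (rev (eigenvalues A))`_0 = last 0 (polyrcf.rootsR p).
  rewrite -(@last_flatten_nseq _ (fun x => mup x p)); last first.
    by move=> x; rewrite rootsE -XsubC_dvd // dvdp_XsubCl.
  by rewrite -/(eigenvalues A); case/lastP: (eigenvalues A) => // s x;
    rewrite rev_rcons last_rcons.
rewrite lt_last_sorted //; last exact: polyrcf.sorted_roots.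
by split=> -[x]; [rewrite rootsE|rewrite -rootsE]; exists x.
Qed.

Lemma near_rat (R : realType) (x : R) (A : set R) :
  nbhs x A -> exists r : rat, A (ratr r).
Proof.
move=> xA; have [||y [Ay [r _ ry]]] := @dense_rat R A°.
- by exists x; exact: nbhs_singleton (nbhs_interior xA).
- exact: open_interior.
by exists r; rewrite ry; exact: interior_subset.
Qed.

(* By compactness, [p] has a root in [[c + 1/(k+1), M]] as soon as it takes
   arbitrarily small values at rational points there; this reduces the
   existence of a root to countably many conditions on values of [p]. *)
Lemma exists_root_gt (R : realType) (p : {poly R}) (c : R) :
  (exists2 x, root p x & c < x) <->
  exists k M : nat, forall m : nat, exists r : rat,
    [/\ c + k.+1%:R^-1 <= ratr r :> R, ratr r <= M%:R :> R
       & `|p.[ratr r]| <= m.+1%:R^-1].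
Proof.
split=> [[x /eqP px cx]|[k [M H]]].
  have [k kx] : exists k, k.+1%:R^-1 < x - c.
    by exists (Num.trunc (x - c)^-1);
       rewrite invf_plt ?posrE ?subr_gt0 // truncnS_gt.
  exists k, (Num.trunc x).+1 => m.
  have m0 : 0 < m.+1%:R^-1 :> R by [].
  (* At [x] itself the three conditions hold with strict inequalities, so by continuity they persist
     nearby, in particular at some rational. *)
  apply: (@near_rat _ x (fun y : R => [/\ c + k.+1%:R^-1 <= y,
    y <= (Num.trunc x).+1%:R & `|p.[y]| <= m.+1%:R^-1])).
  have xM := truncnS_gt x.
  have : p.[y] @[y --> x] --> p.[x] by exact: continuous_horner.
  rewrite px => /cvgr0_norm_lt /(_ _ m0) pm.
  near=> y; split; apply: ltW; near: y => //.
  - by apply: lt_nbhsr; rewrite -ltrBrDl.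
  - by apply: lt_nbhsl.
have [r0 [cr0 rM _]] := H 0%N.
have kM : c + k.+1%:R^-1 <= M%:R :> R by exact: le_trans rM.
(* The root is a point where the absolute value of [p] is minimal on the interval: the minimum is at
   most [1/(m+1)] for every [m]. *)
have [|x] := @EVT_min R (fun y => `|p.[y]|) _ _ kM.
  apply: continuous_subspaceT => y.
  by apply: (@continuous_comp _ _ _ (horner p) (@Num.norm _ R));
    [exact: continuous_horner|exact: norm_continuous].
rewrite in_itv /= => /andP[kx xM] xmin.
exists x; last by apply: lt_le_trans kx; rewrite ltrDl.
rewrite /root -normr_le0; apply/ler_addgt0Pl => e e0; rewrite addr0.
have [r [kr rM' pr]] := H (Num.trunc e^-1).
apply: le_trans (xmin (ratr r) _) _; first by rewrite in_itv /= kr.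
by apply: le_trans pr _; rewrite invf_ple ?posrE // ltW // truncnS_gt.
Unshelve. all: by end_near.
Qed.

(** The Leibniz formula makes the value at [r] a polynomial in the entries. *)
Lemma measurable_char_poly (R : realType) (d : measure_display)
    (T : measurableType d) (m : nat) (A : T -> 'M[R]_m) (r : R) :
  (forall i j, measurable_fun setT (fun w => A w i j)) ->
  measurable_fun setT (fun w => (char_poly (A w)).[r]).
Proof.
move=> mA.
rewrite (_ : (fun _ => _) = fun w => \sum_(s : 'S_m) (-1) ^+ s *
    \prod_i ((r *+ (i == s i)) - A w i (s i))); last first.
  apply/funext => w; rewrite /char_poly -horner_evalE -det_map_mx.
  apply: eq_bigr => s _.
  congr (_ * _); apply: eq_bigr => i _.
  by rewrite !mxE rmorphB rmorphMn /= !horner_evalE hornerX hornerC.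
apply: measurable_sum => s; apply: measurable_funM; first exact: measurable_cst.
apply: measurable_prod => i _; apply: measurable_funB => //.
Qed.

Lemma lt_sqrtr (R : realType) (c a : R) :
  0 <= c -> (c < Num.sqrt a) = (c ^+ 2 < a).
Proof.
move=> c0; have [a0|a0] := ltP 0 a.
  by rewrite -{1}(ger0_norm c0) -sqrtr_sqr ltr_sqrt.
by rewrite ler0_sqrtr // ltNge c0 ltNge (le_trans a0) // sqr_ge0.
Qed.

Lemma measurable_set_ltr (R : realType) (d : measure_display)
    (T : measurableType d) (f g : T -> R) :
  measurable_fun setT f -> measurable_fun setT g ->
  measurable [set w | f w < g w].
Proof.
move=> mf mg; rewrite -[X in measurable X]setTI.
by have /(_ measurableT [set true]) := measurable_fun_ltr mf mg; apply.
Qed.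

Lemma measurable_set_ler (R : realType) (d : measure_display)
    (T : measurableType d) (f g : T -> R) :
  measurable_fun setT f -> measurable_fun setT g ->
  measurable [set w | f w <= g w].
Proof.
by move=> mf mg; rewrite -[X in measurable X]setTI; exact: measurable_fun_le.
Qed.

(** For [c >= 0] the singular value exceeds [c] iff the characteristic polynomial of the Gram matrix
    has a root above [c ^+ 2], which [exists_root_gt] turns into countable unions and intersections
    of measurable conditions. *)
Lemma measurable_singular_value0 (R : realType) (d : measure_display)
    (T : measurableType d) (n p : nat) (X : T -> 'M[R]_(n, p)) :
  (forall i j, measurable_fun setT (fun w => X w i j)) ->
  measurable_fun setT (fun w => singular_value (X w) 0).
Proof.
move=> mX; rewrite /singular_value; case: (0 < minn n p)%N => //.
apply: (measurability _ (RGenOInfty.measurableE R)).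
move=> /= _ [_ [c ->] <-]; rewrite setTI.
have [c0|c0] := leP 0 c; last first.
  rewrite (_ : _ @^-1` _ = setT) //; apply/seteqP; split=> w //= _.
  by rewrite in_itv /= andbT (lt_le_trans c0) // sqrtr_ge0.
pose A w := (X w)^T *m X w.
have mA i j : measurable_fun setT (fun w => A w i j).
  rewrite (_ : (fun _ => _) = fun w => \sum_k X w k i * X w k j); last first.
    by apply/funext => w; rewrite !mxE; apply: eq_bigr => k _; rewrite !mxE.
  by apply: measurable_sum => k; apply: measurable_funM.
rewrite (_ : _ @^-1` _ = \bigcup_k \bigcup_M \bigcap_m \bigcup_(r : rat)
   [set w | [/\ c ^+ 2 + k.+1%:R^-1 <= ratr r :> R, ratr r <= M%:R :> R
       & `|(char_poly (A w)).[ratr r]| <= m.+1%:R^-1]]); last first.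
  apply/seteqP; split => w /=; rewrite in_itv /= andbT lt_sqrtr //.
    move=> /(lt_max_eigenvalue _ (sqr_ge0 c))/exists_root_gt[k [M H]].
    by exists k => //; exists M => // m _; have [r] := H m; exists r.
  move=> [k _ [M _ H]].
  apply/(lt_max_eigenvalue _ (sqr_ge0 c))/exists_root_gt; exists k, M => m.
  by have [r _] := H m I; exists r.
apply: bigcupT_measurable => k; apply: bigcupT_measurable => M.
apply: bigcapT_measurable => m; apply: bigcupT_measurable_rat => r.
rewrite (_ : [set _ | _] =
    [set _ | c ^+ 2 + k.+1%:R^-1 <= ratr r :> R] `&`
    [set _ | ratr r <= M%:R :> R] `&`
    [set w | `|(char_poly (A w)).[ratr r]| <= m.+1%:R^-1]); last first.
  by apply/seteqP; split=> w /= => [[]|[[]]].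
apply: measurableI; first by apply: measurableI; exact: measurable_set_ler.
apply: measurable_set_ler => //.
by apply: measurableT_comp => //; exact: measurable_char_poly.
Qed.

(** * Measurability of sample quantiles *)

(** By [order_stat_lt], being below [c] is a finite union, over the index sets [J] with more than
    [k] elements, of finite intersections of events [x t w < c]. *)
Lemma measurable_order_stat (R : realType) (d : measure_display)
    (U : measurableType d) (T : nat) (x : 'I_T -> U -> R) (j : int) :
  (0 < T)%N -> (forall t, measurable_fun setT (x t)) ->
  measurable_fun setT (fun w => order_stat (x ^~ w) j).
Proof.
move=> T0 mx.
apply: (measurability _ (RGenInftyO.measurableE R)).
move=> /= _ [_ [c ->] <-]; rewrite setTI.
set k := `|Num.min (Num.max j 1) T%:Z|%N.-1.
rewrite (_ : _ @^-1` _ = \bigcup_(J in [set J : {set 'I_T} | (k < #|J|)%N])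
    \bigcap_(t in [set` J]) [set w | x t w < c]); last first.
  apply/seteqP; split=> w /=; rewrite in_itv /= order_stat_lt // -/k.
    move=> kx; exists (finset (fun t => x t w < c)) => /=.
      by rewrite cardsE.
    by move=> t; rewrite /= inE.
  move=> [J /= kJ Jx]; apply: leq_trans kJ _; apply/subset_leq_card.
  by apply/fintype.subsetP => t /Jx; rewrite inE.
apply: fin_bigcup_measurable; first exact: finite_finset.
move=> J _; apply: fin_bigcap_measurable; first exact: finite_finset.
move=> t _; exact: measurable_set_ltr.
Qed.

Lemma measurable_sample_quantile (R : realType) (d : measure_display)
    (U : measurableType d) (ty : quantile_type) (q : R) (T : nat)
    (x : 'I_T -> U -> R) :
  (0 < T)%N -> (forall t, measurable_fun setT (x t)) ->
  measurable_fun setT (fun w => sample_quantile ty q (x ^~ w)).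
Proof.
move=> T0 mx; rewrite /sample_quantile /=.
by apply: measurable_funD; apply: measurable_funM => //;
  exact: measurable_order_stat.
Qed.

(** * The measurable space of matrices *)

Definition matrix_rectangle (R : realType) (n p : nat)
    (B : 'I_n -> 'I_p -> set R) : set 'M[R]_(n, p) :=
  [set X | forall i j, B i j (X i j)].

Definition matrix_rectangles (R : realType) (n p : nat) :
    set (set 'M[R]_(n, p)) :=
  [set matrix_rectangle B | B in [set B | forall i j, measurable (B i j)]].

(** The product sigma-algebra, generated by rectangles because independence of the entries gives
    their probabilities as products. *)
Definition matrix_space (R : realType) (n p : nat) :=
  g_sigma_algebraType (@matrix_rectangles R n p).

Lemma measurable_entry (R : realType) (n p : nat) (i : 'I_n) (j : 'I_p) :
  measurable_fun setT (fun X : matrix_space R n p => (X : 'M[R]_(n, p)) i j).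
Proof.
move=> _ B mB; rewrite setTI; apply: sub_sigma_algebra.
exists (fun i' j' => if (i' == i) && (j' == j) then B else setT).
  by move=> i' j' /=; case: ifP.
apply/seteqP; split=> X /=; first by move=> /(_ i j); rewrite !eqxx.
by move=> BX i' j'; case: ifP => // /andP[/eqP-> /eqP->].
Qed.

Lemma measurable_matrix (R : realType) (d : measure_display)
    (U : measurableType d) (n p : nat) (X : U -> matrix_space R n p) :
  (forall i j, measurable_fun setT (fun w => (X w : 'M[R]_(n, p)) i j)) ->
  measurable_fun setT X.
Proof.
move=> mX; apply: (@measurability _ _ U (matrix_space R n p) setT X
  (@matrix_rectangles R n p)) => //.
move=> _ [_ [B mB <-] <-]; rewrite setTI.
rewrite (_ : _ @^-1` _ = \bigcap_(ij in [set: 'I_n * 'I_p])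
    ((fun w => (X w : 'M[R]_(n, p)) ij.1 ij.2) @^-1` B ij.1 ij.2)); last first.
  apply/seteqP; split=> w /= BX; first by move=> ij _; exact: BX.
  by move=> i j; exact: (BX (i, j) I).
apply: fin_bigcap_measurable; first exact: finite_finset.
by move=> ij _; rewrite -[X in measurable X]setTI; exact: mX.
Qed.

(** Rectangles are closed under intersection and include the whole space, so finite measures
    agreeing on them agree on the sigma-algebra they generate. *)
Lemma matrix_law_unique (R : realType) (d : measure_display)
    (Omega : measurableType d) (P : probability Omega R) (n p : nat)
    (X Y : Omega -> matrix_space R n p) :
  measurable_fun setT X -> measurable_fun setT Y ->
  (forall B, (forall i j, measurable (B i j)) ->
     P (X @^-1` matrix_rectangle B) = P (Y @^-1` matrix_rectangle B)) ->
  forall A, measurable A -> P (X @^-1` A) = P (Y @^-1` A).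
Proof.
move=> mX mY XY A mA.
pose X' : {mfun Omega >-> matrix_space R n p} := mfun_Sub (mem_set mX).
pose Y' : {mfun Omega >-> matrix_space R n p} := mfun_Sub (mem_set mY).
rewrite -[LHS]/(distribution P X' A) -[RHS]/(distribution P Y' A).
apply: (@measure_unique _ R (matrix_space R n p) (@matrix_rectangles R n p)
  (fun=> setT)) => //.
- move=> _ _ [B mB <-] [C mC <-]; exists (fun i j => B i j `&` C i j).
    by move=> i j; exact: measurableI.
  apply/seteqP; split=> Z /= ; last by move=> [BZ CZ] i j.
  by move=> H; split=> i j; case: (H i j).
- move=> _; exists (fun _ _ => setT) => //.
  by apply/seteqP; split.
- by rewrite bigcup_const.
- by move=> _ [B mB <-]; exact: XY.
- move=> _; rewrite /= /distribution /pushforward preimage_setT.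
  by rewrite probability_setT ltry.
Qed.

(** * Sign flips and the invariance of the law of the noise *)

(** Boolean matrices form a finite type over which one can sum and count; [true] stands for -1, and
    entrywise products of signs become [addb]. *)
Definition sign_mx (R : realType) (n p : nat) (b : 'M[bool]_(n, p)) :
    'M[R]_(n, p) :=
  map_mx (fun c : bool => (-1) ^+ c) b.

Lemma signflipM (R : realType) (n p : nat) (b c : 'M[bool]_(n, p))
    (X : 'M[R]_(n, p)) :
  signflip (sign_mx R b) (signflip (sign_mx R c) X) =
  signflip (sign_mx R (map2_mx addb b c)) X.
Proof. by apply/matrixP => i j; rewrite !mxE mulrA signr_addb. Qed.

(** Puts matrix events into the sigma-algebras to which the independence hypotheses apply. The index
    map [f] lets one statement serve a single trial, all trials jointly, and the noise. *)
Lemma generated_sigma_random_matrix (R : realType) (d : measure_display)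
    (Omega : measurableType d) (P : probability Omega R) (n p : nat)
    (I : Type) (Y : I -> {RV P >-> R}) (f : 'I_n -> 'I_p -> I)
    (A : set (matrix_space R n p)) :
  measurable A ->
  generated_sigma Y (random_matrix (fun i j => Y (f i j)) @^-1` A).
Proof.
move=> mA; rewrite /generated_sigma; set G := bigcup _ _.
suff mX : measurable_fun setT
    (random_matrix (fun i j => Y (f i j))
       : g_sigma_algebraType G -> matrix_space R n p).
  by have := mX measurableT _ mA; rewrite setTI.
apply: measurable_matrix => i j.
rewrite (_ : (fun _ => _) = Y (f i j)); last by apply/funext => w; rewrite mxE.
move=> _ B mB; apply: sub_sigma_algebra; exists (f i j) => //.
by exists B.
Qed.

Lemma measurable_signflip_random_matrix (R : realType) (d : measure_display)
    (Omega : measurableType d) (P : probability Omega R) (n p : nat)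
    (N : 'I_n -> 'I_p -> {RV P >-> R}) (b : 'M[bool]_(n, p)) :
  measurable_fun setT
    (fun w => signflip (sign_mx R b) (random_matrix N w) : matrix_space R n p).
Proof.
apply: measurable_matrix => i j.
rewrite (_ : (fun _ => _) = fun w => (-1) ^+ b i j * N i j w).
  exact: measurable_funM.
by apply/funext => w; rewrite !mxE.
Qed.

(** On a rectangle, independence gives a product over the entries, and symmetry leaves each factor
    unchanged by a sign. Rectangles determine the law. *)
Lemma law_signflip (R : realType) (d : measure_display)
    (Omega : measurableType d) (P : probability Omega R) (n p : nat)
    (N : 'I_n -> 'I_p -> {RV P >-> R}) (b : 'M[bool]_(n, p))
    (A : set (matrix_space R n p)) :
  independent_entries N ->
  (forall i j, symmetric_distribution (N i j)) ->
  measurable A ->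
  P [set w | A (signflip (sign_mx R b) (random_matrix N w))] =
  P [set w | A (random_matrix N w)].
Proof.
move=> iN sN mA.
have mN := measurable_signflip_random_matrix N.
(* Writing [N] as its flip by the all-[false] matrix lets [rectE] treat both sides. *)
have flip0 X : signflip (sign_mx R (const_mx false)) X = X :> 'M[R]_(n, p).
  by apply/matrixP => i j; rewrite !mxE expr0 mul1r.
under [in RHS]eq_set do rewrite -(flip0 (random_matrix N _)).
apply: (matrix_law_unique (mN b) (mN (const_mx false))) => // B mB.
have rectE (s : 'M[bool]_(n, p)) :
    P ((fun w => signflip (sign_mx R s) (random_matrix N w))
         @^-1` matrix_rectangle B) =
    (\prod_(ij : 'I_n * 'I_p)
       P [set w | B ij.1 ij.2 ((-1) ^+ s ij.1 ij.2 * N ij.1 ij.2 w)%R])%E.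
  pose A' (ij : 'I_n * 'I_p) :=
    N ij.1 ij.2 @^-1` [set x | B ij.1 ij.2 ((-1) ^+ s ij.1 ij.2 * x)].
  rewrite (_ : _ @^-1` _ = \bigcap_(ij in [set` [set: 'I_n * 'I_p]%SET]) A' ij).
    rewrite iN; last first.
      move=> [i j] _; apply: sub_sigma_algebra; exists tt => //.
      exists [set x | B i j ((-1) ^+ s i j * x)]; last by rewrite setTI.
      rewrite -[X in measurable X]setTI.
      by apply: (mulrl_measurable ((-1) ^+ s i j)) => //; exact: measurableT.
    by apply: eq_bigl => ij; rewrite finset.in_setT.
  apply/seteqP; split=> w /= Bw.
    by move=> ij _; have := Bw ij.1 ij.2; rewrite !mxE.
  by move=> i j; rewrite !mxE; apply: (Bw (i, j)); rewrite /= finset.in_setT.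
rewrite !rectE; apply: eq_bigr => -[i j] _ /=; rewrite mxE.
under [in RHS]eq_set do rewrite expr0 mul1r.
case: (b i j).
  under eq_set do rewrite expr1 mulN1r.
  exact/esym/sN.
by under eq_set do rewrite expr0 mul1r.
Qed.

(** * Two facts on finite families of events *)

(** The sum is the expected number of events that occur, and this number never exceeds [m]. *)
Lemma sum_probability_le (R : realType) (d : measure_display)
    (Omega : measurableType d) (P : probability Omega R) (I : finType)
    (F : I -> set Omega) (m : R) :
  (forall i, measurable (F i)) ->
  (forall w, #|[pred i | w \in F i]|%:R <= m) ->
  (\sum_i P (F i) <= m%:E)%E.
Proof.
move=> mF Fm.
have -> : (\sum_i P (F i) = \int[P]_w \sum_i (\1_(F i) w)%:E)%E.
  rewrite ge0_integral_sum //; last by move=> i; exact/measurable_EFinP.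
  by apply: eq_bigr => i _; rewrite integral_indic // setIT.
have -> : m%:E = (\int[P]_w m%:E)%E.
  by rewrite integral_cst // [X in (_ * X)%E]probability_setT mule1.
apply: ge0_le_integral => //.
- by move=> w _; apply: sume_ge0 => i _; rewrite lee_fin.
- by apply: emeasurable_sum => i; apply/measurable_EFinP.
move=> w _; rewrite sumEFin lee_fin; apply: le_trans (Fm w).
rewrite (eq_bigr (fun i => (w \in F i)%:R)).
  rewrite -natr_sum ler_nat.
  by rewrite -sum1_card [leqRHS]big_mkcond leq_sum.
by move=> i _; rewrite indicE.
Qed.

(** Law of total probability when the union of the [F i] has probability 1 but may miss a null set;
    this fits [uniform_signs], which makes the entries signs only almost surely. *)
Lemma probability_partition (R : realType) (d : measure_display)
    (Omega : measurableType d) (P : probability Omega R) (I : finType)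
    (F : I -> set Omega) (A : set Omega) :
  (forall i, measurable (F i)) -> trivIset setT F ->
  (\sum_i P (F i) = 1)%E -> measurable A ->
  P A = (\sum_i P (A `&` F i))%E.
Proof.
move=> mF tF F1 mA.
have fsum (H : I -> set Omega) : (forall i, measurable (H i)) ->
    trivIset setT H -> P (\bigcup_i H i) = (\sum_i P (H i))%E.
  move=> mH tH; rewrite measure_fin_bigcup //; last exact: finite_finset.
  rewrite (fsbigE (index_enum I)) ?index_enum_uniq //.
    by apply: eq_bigl => i; rewrite in_setT.
  by move=> i _; rewrite mem_index_enum.
have mU : measurable (\bigcup_i F i).
  by apply: fin_bigcup_measurable => //; exact: finite_finset.
rewrite -fsum; [|by move=> i; exact: measurableI|exact: trivIset_setIl].
rewrite -setI_bigcupr -[in LHS](setIT A) -(setUv (\bigcup_i F i)) setIUr.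
rewrite measureU ?[X in (_ + X)%E](_ : _ = 0%E) ?adde0 //.
- apply/eqP; rewrite eq_le measure_ge0 andbT.
  apply: (@le_trans _ _ (P (~` \bigcup_i F i))).
    apply: le_measure; rewrite ?inE //; last exact: measurableC.
    by apply: measurableI => //; exact: measurableC.
  by rewrite probability_setC // fsum // F1 subee.
- exact: measurableI.
- by apply: measurableI => //; exact: measurableC.
- by rewrite setIACA setICr setI0.
Qed.

(** * Counting form of exchangeability *)

(** Transposing [i] and [i0] shows that the rank condition holds at [i] for as many functions as at
    [i0]. Summing over [i] and exchanging the sums leaves, for each function, the number of indices
    of rank at least [k], bounded by [card_rank_ge]. *)
Lemma card_rank_ge_exchangeable (R : realType) (I G : finType) (i0 : I)
    (y : G -> R) (k : nat) :
  (#|[pred h : {ffun I -> G} |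
        k <= #|[pred j | (y (h j) < y (h i0))%R]|]| * #|I| <=
     (#|I| - k) * #|G| ^ #|I|)%N.
Proof.
pose C i (h : {ffun I -> G}) := (k <= #|[pred j | (y (h j) < y (h i))%R]|)%N.
have CE i : #|[pred h | C i h]| = #|[pred h | C i0 h]|.
  pose sw (h : {ffun I -> G}) := [ffun j => h (tperm i i0 j)].
  have swK : involutive sw by move=> h; apply/ffunP => j; rewrite !ffunE tpermK.
  rewrite -!sum1_card (reindex_inj (inv_inj swK)); apply: eq_bigl => h.
  rewrite !inE /C; congr (_ <= _)%N; rewrite -!sum1_card.
  rewrite (reindex_inj (@perm_inj _ (tperm i i0))); apply: eq_bigl => j.
  by rewrite !inE !ffunE tpermL tpermK.
rewrite -[X in (X * _)%N]/(#|[pred h | C i0 h]|) mulnC -sum_nat_const.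
under eq_bigr => i _ do rewrite -(CE i) -sum1_card big_mkcond /=.
rewrite exchange_big /= mulnC -card_ffun -sum_nat_const; apply: leq_sum => h _.
by rewrite -big_mkcond sum1_card card_rank_ge.
Qed.

(** * The event of a positive output, for fixed signs *)

(** At index 0 both comparison methods make the same test, and the least stopping index is positive
    exactly when it fails. *)
Lemma flippa_gt0 (R : realType) (cmp : comparison_method)
    (ty : quantile_type) (q tau : R) (tau0 : 0 <= tau) (n p T : nat)
    (X : 'M[R]_(n, p)) (S : 'I_T -> 'M[R]_(n, p)) :
  (0 < flippa cmp ty q tau0 X S)%N =
  (sample_quantile ty q (fun t => singular_value (signflip (S t) X) 0) + tau
     < singular_value X 0).
Proof.
rewrite ltNge /flippa; case: ex_minnP => m stop_m min_m.
have -> : (singular_value X 0 <= sample_quantile ty q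
    (fun t => singular_value (signflip (S t) X) 0) + tau) =
    flippa_stop cmp ty q tau X S 0.
  by rewrite /flippa_stop; case: cmp {stop_m min_m}.
apply/idP/idP => [m0|]; first by apply/negP => /min_m; rewrite leqNgt m0.
by rewrite lt0n; apply: contraNneq => m0; rewrite -m0.
Qed.

Lemma sign_mx_inj (R : realType) (n p : nat) : injective (@sign_mx R n p).
Proof.
move=> b c /matrixP bc; apply/matrixP => i j.
by have := bc i j; rewrite !mxE => /signr_inj.
Qed.

Lemma sign_mx_pm1 (R : realType) (n p : nat) (b : 'M[bool]_(n, p)) i j :
  sign_mx R b i j = 1 \/ sign_mx R b i j = -1.
Proof. by rewrite mxE; case: (b i j); [right|left]. Qed.

Lemma measurable_singleton (R : realType) (n p : nat) (X : 'M[R]_(n, p)) :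
  measurable ([set X] : set (matrix_space R n p)).
Proof.
apply: sub_sigma_algebra; exists (fun i j => [set X i j]) => //.
by apply/seteqP; split => Y /=; [move=> H; apply/matrixP|move=> ->].
Qed.

(** The signs are fixed parameters, so that this is a set of data matrices to which the law of the
    noise applies. *)
Definition flip_event (R : realType) (ty : quantile_type) (q tau : R)
    (n p T : nat) (s : 'I_T -> 'M[R]_(n, p)) : set (matrix_space R n p) :=
  [set X | sample_quantile ty q (fun t => singular_value (signflip (s t) X) 0)
             + tau < singular_value X 0].

Lemma measurable_flip_event (R : realType) (ty : quantile_type) (q tau : R)
    (n p T : nat) (s : 'I_T -> 'M[R]_(n, p)) :
  (0 < T)%N -> measurable (flip_event ty q tau s).
Proof.
move=> T0; apply: measurable_set_ltr.
  apply: measurable_funD => //; apply: measurable_sample_quantile => // t.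
  apply: measurable_singular_value0 => i j.
  rewrite (_ : (fun _ => _) = fun X : matrix_space R n p =>
      s t i j * (X : 'M[R]_(n, p)) i j).
    by apply: measurable_funM => //; exact: measurable_entry.
  by apply/funext => X; rewrite mxE.
by apply: measurable_singular_value0; exact: measurable_entry.
Qed.

(* [(s, g) |-> (g, s_1 g, ..., s_T g)] is injective into tuples of [T + 1] sign
   matrices. *)
Lemma card_flip_event (R : realType) (ty : quantile_type) (q tau : R)
    (n p T : nat) (X : 'M[R]_(n, p)) :
  0 <= q <= 1 -> 0 <= tau -> (0 < T)%N ->
  (#|[pred sg : {ffun 'I_T -> 'M[bool]_(n, p)} * 'M[bool]_(n, p) |
      signflip (sign_mx R sg.2) X \in
        flip_event ty q tau (fun t => sign_mx R (sg.1 t))]| * T.+1 <=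
   (T.+1 - `|Num.floor (q * T%:R)|) * #|{: 'M[bool]_(n, p)}| ^ T.+1)%N.
Proof.
move=> q01 tau0 T0; set k := `|_|%N.
pose y (g : 'M[bool]_(n, p)) := singular_value (signflip (sign_mx R g) X) 0.
have := card_rank_ge_exchangeable (None : option 'I_T) y k.
rewrite card_option card_ord; apply: leq_trans; rewrite leq_mul2r /=.
pose h (sg : {ffun 'I_T -> 'M[bool]_(n, p)} * 'M[bool]_(n, p)) :
    {ffun option 'I_T -> 'M[bool]_(n, p)} :=
  [ffun i => if i is Some t then map2_mx addb (sg.1 t) sg.2 else sg.2].
have h_inj : injective h.
  move=> [s g] [s' g'] /ffunP E.
  have gg : g = g' by have := E None; rewrite !ffunE.
  rewrite -gg in E *; congr pair; apply/ffunP => t.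
  have /matrixP Et := E (Some t); apply/matrixP => i j.
  by have := Et i j; rewrite !ffunE !mxE /=; apply: addIb.
rewrite -(fintype.card_image h_inj); apply/subset_leq_card.
apply/fintype.subsetP => _ /fintype.imageP[[s g] sg ->].
move: sg => /set_mem /= sg; rewrite inE [h _ None]ffunE /=.
have yE : (fun t => singular_value (signflip (sign_mx R (s t))
    (signflip (sign_mx R g) X)) 0) = (fun t => y (h (s, g) (Some t))).
  by apply/funext => t; rewrite signflipM /y ffunE.
rewrite /flip_event /= yE -/(y g) in sg.
apply: (@leq_trans #|[pred t | y (h (s, g) (Some t)) < y g]|).
  (* As [tau >= 0], the quantile alone is also below [y g]. *)
  apply: (floor_le_count_lt (ty := ty) q01 T0 (le_lt_trans _ sg)).
  by rewrite lerDl.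
(* The values below [y g] among the trials bound from below the rank of [None] among all [T + 1]
   indices. *)
rewrite -(fintype.card_image (@Some_inj _)).
apply/subset_leq_card; apply/fintype.subsetP => _ /fintype.imageP[t + ->].
by rewrite !inE.
Qed.

(** * Events in generated sigma-algebras *)

Lemma generated_sigma_measurable (R : realType) (d : measure_display)
    (Omega : measurableType d) (P : probability Omega R) (I : Type)
    (Y : I -> {RV P >-> R}) (A : set Omega) :
  generated_sigma Y A -> measurable A.
Proof.
apply: smallest_sub; first exact: sigma_algebra_measurable.
by move=> _ [i _ [B mB <-]]; exact: measurable_funPT.
Qed.

Lemma generated_sigma_bigcap (R : realType) (d : measure_display)
    (Omega : measurableType d) (P : probability Omega R) (I : Type)
    (Y : I -> {RV P >-> R}) (J : finType) (A : J -> set Omega) :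
  (forall j, generated_sigma Y (A j)) -> generated_sigma Y (\bigcap_j A j).
Proof.
rewrite /generated_sigma; set H := bigcup _ _ => mA.
apply: (@fin_bigcap_measurable _ (g_sigma_algebraType H) _ _ A).
  exact: finite_finset.
by move=> j _; exact: mA.
Qed.

(** * Conditioning on the drawn signs and averaging over flips of the noise *)

Theorem proposition3p2 (R : realType) (d : measure_display)
    (Omega : measurableType d) (P : probability Omega R) (n p T : nat)
    (N : 'I_n -> 'I_p -> {RV P >-> R})
    (S : 'I_T -> 'I_n -> 'I_p -> {RV P >-> R})
    (q tau : R) (tau0 : 0 <= tau)
    (cmp : comparison_method) (ty : quantile_type) :
  independent_entries N ->
  (forall i j, symmetric_distribution (N i j)) ->
  (forall t, uniform_signs (S t)) ->
  independent_matrices S ->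
  jointly_independent_of S N ->
  0 <= q <= 1 ->
  (1 <= T)%N ->
  (P [set w | (0 < flippa cmp ty q tau0 (random_matrix N w)
                     (fun t => random_matrix (S t) w))%N]
     <= (1 - (Num.floor (q * T%:R))%:~R / T.+1%:R)%:E)%E.
Proof.
move=> iN sN uS iS SN q01 T0.
pose E := [set w | flip_event ty q tau (fun t => random_matrix (S t) w)
                     (random_matrix N w)].
rewrite (_ : [set _ | _] = E); last first.
  by apply/seteqP; split=> w /=; rewrite flippa_gt0.
have mE : measurable E.
  apply: measurable_set_ltr.
    apply: measurable_funD => //; apply: measurable_sample_quantile => // t.
    apply: measurable_singular_value0 => i j.
    rewrite (_ : (fun _ => _) = fun w => S t i j w * N i j w).
      exact: measurable_funM.
    by apply/funext => w; rewrite !mxE.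
  apply: measurable_singular_value0 => i j.
  by rewrite (_ : (fun _ => _) = N i j) //; apply/funext => w; rewrite !mxE.
pose F1 t b := [set w | random_matrix (S t) w = sign_mx R b].
pose F (s : {ffun 'I_T -> 'M[bool]_(n, p)}) := \bigcap_t F1 t (s t).
(* Membership for a single trial serves the independence between trials; membership of [F s] in the
   joint sigma-algebra serves the independence from [N]. *)
have genF1 t b :
    generated_sigma (fun ij : 'I_n * 'I_p => S t ij.1 ij.2) (F1 t b).
  exact: (generated_sigma_random_matrix
    (Y := fun ij : 'I_n * 'I_p => S t ij.1 ij.2) (@pair _ _)
    (measurable_singleton (sign_mx R b))).
have genF s : generated_sigma
    (fun tij : 'I_T * 'I_n * 'I_p => S tij.1.1 tij.1.2 tij.2) (F s).
  apply: generated_sigma_bigcap => t.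
  exact: (generated_sigma_random_matrix
    (Y := fun tij : 'I_T * 'I_n * 'I_p => S tij.1.1 tij.1.2 tij.2)
    (fun i j => (t, i, j)) (measurable_singleton (sign_mx R (s t)))).
have mF s : measurable (F s) := generated_sigma_measurable (genF s).
pose c : R := 2 ^+ (n * p).
have c0 : 0 < c by rewrite exprn_gt0.
have cardG : #|{: 'M[bool]_(n, p)}|%:R = c by rewrite card_mx card_bool natrX.
have PF s : P (F s) = (c ^- T)%:E.
  have setTE : [set: 'I_T] = [set` [set: 'I_T]%SET].
    by apply/seteqP; split=> t //= _; rewrite finset.in_setT.
  rewrite /F setTE.
  rewrite iS; last by move=> t _; exact: genF1.
  rewrite (eq_bigr (fun=> (c^-1)%:E)); last first.
    by move=> t _; apply: uS; exact: sign_mx_pm1.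
  by rewrite prodEFin prodr_const cardsT card_ord exprVn.
have F_triv : trivIset setT F.
  move=> s s' _ _ [w [sw s'w]]; apply/ffunP => t.
  by apply: (@sign_mx_inj R); rewrite -(sw t I) -(s'w t I).
have F_sum : (\sum_s P (F s) = 1)%E.
  under eq_bigr do rewrite PF.
  rewrite sumEFin sumr_const card_ffun card_ord -mulr_natr natrX cardG.
  by rewrite mulVf // expf_neq0 // gt_eqF.
pose A (s : {ffun 'I_T -> 'M[bool]_(n, p)}) :=
  flip_event ty q tau (fun t => sign_mx R (s t)).
have mA s : measurable (A s) by exact: measurable_flip_event.
(* Flipping the noise by [g] keeps the probability of [A s], so each such probability can be
   averaged over all [g]. *)
pose B s g := [set w | A s (signflip (sign_mx R g) (random_matrix N w))].
have PB s g : P (B s g) = P [set w | A s (random_matrix N w)].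
  exact: (law_signflip g iN sN (mA s)).
have genA s : generated_sigma (fun ij : 'I_n * 'I_p => N ij.1 ij.2)
    [set w | A s (random_matrix N w)].
  exact: (generated_sigma_random_matrix
    (Y := fun ij : 'I_n * 'I_p => N ij.1 ij.2) (@pair _ _) (mA s)).
(* On [F s] the drawn signs are those of [s], so [E] becomes an event on [N] alone, independent of
   [F s]. *)
have PEF s : P (E `&` F s) =
    ((c ^- T)%:E * P [set w | A s (random_matrix N w)])%E.
  have -> : E `&` F s = F s `&` [set w | A s (random_matrix N w)].
    have EA w : F s w -> E w = A s (random_matrix N w).
      move=> sw.
      have Sw : (fun t => random_matrix (S t) w) = (fun t => sign_mx R (s t)).
        by apply/funext => t; exact: sw.
      exact: (congr1 (fun u => flip_event ty q tau u (random_matrix N w)) Sw).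
    apply/seteqP; split=> w /=.
      by move=> [Ew sw]; split; [exact: sw|rewrite -(EA w sw); exact: Ew].
    by move=> [sw Aw]; split; [rewrite (EA w sw); exact: Aw|exact: sw].
  have SNs := SN _ _ (genF s) (genA s).
  rewrite SNs.
  by rewrite PF.
pose k := `|Num.floor (q * T%:R)|%N.
have kE : (Num.floor (q * T%:R))%:~R = k%:R :> R.
  rewrite -[Num.floor _]gez0_abs // floor_ge0 mulr_ge0 //.
  by case/andP: q01.
have kT : (k <= T)%N.
  have /andP[q0 q1] := q01; rewrite -(ler_nat R) -kE.
  by apply: le_trans (floor_le _) _; rewrite ler_piMl.
pose r s := fine (P [set w | A s (random_matrix N w)]).
have PA s : P [set w | A s (random_matrix N w)] = (r s)%:E.
  apply/esym/fineK.
  exact: (fin_num_measure P _ (generated_sigma_measurable (genA s))).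
have mB s g : measurable (B s g).
  have := measurable_signflip_random_matrix N g measurableT (mA s).
  by rewrite setTI.
(* The bound of [card_flip_event] on the number of pairs [(s, g)] whose event [B s g] occurs, valid
   at every sample point. *)
pose m : R := (T.+1 - k)%:R * c ^+ T.+1 / T.+1%:R.
have : (\sum_sg P (B sg.1 sg.2) <= m%:E)%E.
  apply: sum_probability_le => [sg|w]; first exact: mB.
  rewrite ler_pdivlMr // -cardG -natrX -!natrM ler_nat.
  have := card_flip_event ty (random_matrix N w) q01 tau0 T0.
  apply: leq_trans; rewrite leq_mul2r; apply/orP; right.
  apply/subset_leq_card; apply/fintype.subsetP => sg /set_mem Bsg.
  by apply: mem_set; exact: Bsg.
under eq_bigr do rewrite PB PA.
(* Each [r s] appears once for every [g], hence the factor [c], the number of sign matrices. *)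
rewrite sumEFin lee_fin -(pair_bigA _ (fun s g => r s)) /=.
under eq_bigr do rewrite sumr_const -mulr_natr cardG.
rewrite -mulr_suml => rm.
rewrite (probability_partition mF F_triv F_sum mE).
under eq_bigr do rewrite PEF PA -EFinM.
rewrite sumEFin lee_fin -mulr_sumr kE ler_pdivrMl ?exprn_gt0 //.
rewrite -(ler_pM2r c0); apply: le_trans rm _.
(* As [k <= T], the natural subtraction in [m] is not truncated, and the two sides are equal. *)
rewrite /m natrB ?leqW // exprS.
rewrite le_eqVlt; apply/orP; left; apply/eqP.
by field.
Qed.
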